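(* Let $X$ be a path-connected topological space with base point $x_0$, let $\mathbb{G}(X)$ be the group of all homeomorphisms from $X$ to itself, and let $\mathbb{G}(X)_{x_0}$ be the isotropy subgroup at $x_0$. Then there is the following short exact sequence $$1\longrightarrow\pi_1(X,x_0)\longrightarrow\pi_1^E(X,x_0,\mathbb{G}(X)(x_0))\longrightarrow\mathbb{G}(X)/\mathbb{G}(X)_{x_0}\longrightarrow1,$$ where the second map is $\Delta([\alpha])=g_{\alpha(1)}\mathbb{G}(X)_{x_0}$, which is surjective and for which the preimage of the coset $\mathbb{G}(X)_{x_0}$ is exactly $\pi_1(X,x_0)$. If $\mathbb{G}(X)_{x_0}$ is a normal subgroup of $\mathbb{G}(X)$, then this is a short exact sequence in the sense of group homomorphisms; otherwise, it is a short exact sequence in the sense of maps.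
   Context: Here $I=[0,1]$ and $\mathbb{G}(X)(x_0)$ denotes the orbit of $x_0$ under $\mathbb{G}(X)$. For each point $x\in\mathbb{G}(X)(x_0)$ there is a unique coset $g\mathbb{G}(X)_{x_0}\in\mathbb{G}(X)/\mathbb{G}(X)_{x_0}$ such that $x=hx_0$ for every $h\in g\mathbb{G}(X)_{x_0}$; for each such $x$ a representative of this coset is fixed once and for all and denoted by $g_x$, so that $x=g_xx_0$. $\pi_1^E(X,x_0,\mathbb{G}(X)(x_0))$, called the extended fundamental group of $X$ at $\mathbb{G}(X)(x_0)$, is the set of homotopy classes relative to $\partial I$ of paths $\alpha:I\to X$ with $\alpha(0)=x_0$ and $\alpha(1)\in\mathbb{G}(X)(x_0)$, equipped with the operation $[\alpha]\bullet[\beta]=[\alpha\circ(g_{\alpha(1)}\beta)]$, where $\circ$ is the usual concatenation of paths (first $\alpha$, then $g_{\alpha(1)}\beta$); the paper asserts that this is a group. It depends on the choices of the representatives $g_x$.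
   Formalization: The group-homomorphism half assumes that the product on the extended fundamental group is a group law for the chosen representatives g_x; this fails in general, e.g. for a figure eight based at its wedge point with g_{x0} swapping the two circles. *)

(* Defs.v *)
From HB Require Import structures.
From mathcomp Require Import all_boot all_order all_algebra.
From mathcomp Require Import generic_quotient.
From mathcomp Require Import all_classical all_reals topology normedtype.
From mathcomp Require Import continuous_path ring lra.

Set Implicit Arguments.
Unset Strict Implicit.
Unset Printing Implicit Defensive.

Import Order.TTheory GRing.Theory Num.Theory.
Import numFieldNormedType.Exports.

Local Open Scope classical_set_scope.
Local Open Scope ring_scope.
Local Open Scope quotient_scope.

Definition unit_interval (R : realType) : Type := `[0%R, 1%R]%classic : set R.

Section UnitInterval.
Variable R : realType.
Local Notation I := (unit_interval R).

HB.instance Definition _ := Topological.on I.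

Definition ival (t : I) : R := set_val t.

Lemma ival_ge0 (t : I) : 0 <= ival t.
Proof.
by rewrite /ival; have := set_valP t; rewrite /= in_itv /= => /andP[].
Qed.

Lemma ival_le1 (t : I) : ival t <= 1.
Proof.
by rewrite /ival; have := set_valP t; rewrite /= in_itv /= => /andP[].
Qed.

Lemma ival_inj : injective ival.
Proof. by move=> s t; apply: val_inj. Qed.

Lemma clamp_subproof (r : R) :
  Num.min (Num.max r 0) 1 \in (`[0%R, 1%R]%classic : set R).
Proof.
rewrite inE /= in_itv /= le_min ge_min le_max !lexx ler01 !orbT //.
Qed.

(* The retraction of R onto [0, 1]; it lets one write formulas such as
   [p (2 t)] for a path [p] without carrying membership proofs. *)
Definition clamp (r : R) : I :=
  exist (fun x : R => x \in (`[0%R, 1%R]%classic : set R)) _ (clamp_subproof r).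

Lemma clampE (r : R) : 0 <= r <= 1 -> ival (clamp r) = r.
Proof. by move=> /andP[r0 r1]; rewrite /ival set_valE /= max_l // min_l. Qed.

Lemma ivalK (t : I) : clamp (ival t) = t.
Proof. by apply: ival_inj; rewrite clampE // ival_ge0 ival_le1. Qed.

Lemma clamp_ge1 (r : R) : 1 <= r -> clamp r = clamp 1.
Proof.
move=> r1; apply: ival_inj; rewrite [RHS]clampE ?ler01 ?lexx //.
rewrite /ival set_valE /= max_l; first by rewrite min_r.
exact: le_trans r1.
Qed.

Lemma clamp_le0 (r : R) : r <= 0 -> clamp r = clamp 0.
Proof.
move=> r0; apply: ival_inj; rewrite [RHS]clampE ?ler01 ?lexx //.
by rewrite /ival set_valE /= max_r // min_l.
Qed.

Lemma clamp01_subproof : clamp 0 != clamp 1.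
Proof.
apply/eqP => /(congr1 ival); rewrite !clampE ?lexx ?ler01 // => /esym/eqP.
by rewrite oner_eq0.
Qed.

HB.instance Definition _ := isBiPointed.Build I clamp01_subproof.

Lemma ival0 : ival zero = 0. Proof. by rewrite clampE // lexx ler01. Qed.
Lemma ival1 : ival one = 1. Proof. by rewrite clampE // lexx ler01. Qed.

Lemma ival_continuous : continuous ival.
Proof. exact: initial_continuous. Qed.

Lemma clamp_continuous : continuous clamp.
Proof.
apply: continuous_comp_initial => r.
apply: (@continuous_min R R (fun r => Num.max r 0) (cst 1)).
  by apply: (@continuous_max R R id (cst 0)); [exact: cvg_id|exact: cvg_cst].
exact: cvg_cst.
Qed.

End UnitInterval.

Section Pasting.
Variables (R : realType) (T X : topologicalType).

Lemma continuous_paste (h : T -> R) (c : R) (f f' : T -> X) :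
  continuous h -> continuous f -> continuous f' ->
  (forall t, h t = c -> f t = f' t) ->
  continuous (fun t => if h t <= c then f t else f' t).
Proof.
move=> ch cf cf' eqf t.
have [lt|gt|eq] := ltgtP (h t) c.
- move=> V; rewrite /= (ltW lt) => fV.
  have := cf t V fV; rewrite /= !nbhs_simpl.
  have : \forall s \near t, h s < c.
    by apply: (ch t [set x | x < c]); exact: lt_nbhsl.
  apply: filterS2 => s /ltW /= -> //.
- move=> V; rewrite /= leNgt gt /= => fV.
  have := cf' t V fV; rewrite /= !nbhs_simpl.
  have : \forall s \near t, c < h s.
    by apply: (ch t [set x | c < x]); exact: lt_nbhsr.
  by apply: filterS2 => s /=; rewrite ltNge => /negbTE ->.
- move=> V; rewrite /= eq lexx => fV.
  have fVt : nbhs t (f @^-1` V) := cf t V fV.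
  have fV' : nbhs (f' t) V by rewrite -eqf.
  have fVt' : nbhs t (f' @^-1` V) := cf' t V fV'.
  by apply: filterS2 fVt fVt' => s /=; case: ifP.
Qed.

End Pasting.

Section ContinuityHelpers.
Variables (R : realType) (T : topologicalType).
Local Notation I := (unit_interval R).
Lemma continuous_clamp (h : T -> R) :
  continuous h -> continuous (fun t => clamp (h t)).
Proof.
by move=> ch t; apply: (@continuous_comp _ _ _ h (@clamp R));
  [exact: ch|exact: clamp_continuous].
Qed.

Lemma continuous_ival (h : T -> I) :
  continuous h -> continuous (fun t => ival (h t)).
Proof.
by move=> ch t; apply: (@continuous_comp _ _ _ h (@ival R));
  [exact: ch|exact: ival_continuous].
Qed.

Lemma continuous_path_comp (S U : topologicalType) (h : T -> S) (p : S -> U) :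
  continuous h -> continuous p -> continuous (fun t => p (h t)).
Proof. by move=> ch cp t; apply: continuous_comp; [exact: ch|exact: cp]. Qed.

Lemma continuous_pair (S U : topologicalType) (h : T -> S) (k : T -> U) :
  continuous h -> continuous k -> continuous (fun t => (h t, k t)).
Proof. by move=> ch ck t; apply: cvg_pair; [exact: ch|exact: ck]. Qed.

Lemma continuous_minr (f g : T -> R) :
  continuous f -> continuous g -> continuous (fun t => Num.min (f t) (g t)).
Proof.
by move=> cf cg t; apply: (@continuous_min R T f g); [exact: cf|exact: cg].
Qed.

Lemma continuous_affine (h : T -> R) (a b : R) :
  continuous h -> continuous (fun t => a * h t + b).
Proof.
move=> ch t; apply: cvgD; last exact: cvg_cst.
by apply: cvgM; [exact: cvg_cst|exact: ch].
Qed.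
End ContinuityHelpers.

Section Homotopy.
Variables (R : realType) (X : topologicalType).
Local Notation I := (unit_interval R).

Definition homotopic_rel_ends (p q : I -> X) : Prop :=
  exists H : I * I -> X,
    [/\ continuous H,
        forall t, H (t, zero) = p t,
        forall t, H (t, one) = q t,
        forall s, H (zero, s) = p zero &
        forall s, H (one, s) = p one].

Lemma homotopic_refl (p : I -> X) : continuous p -> homotopic_rel_ends p p.
Proof.
move=> cp; exists (p \o fst); split => // -[t s] /=.
by apply: continuous_comp; [exact: cvg_fst|exact: cp].
Qed.

Lemma homotopic_ends (p q : I -> X) :
  homotopic_rel_ends p q -> p zero = q zero /\ p one = q one.
Proof. by move=> [H [_ _ Hq H0 H1]]; rewrite -(H0 one) -(H1 one) !Hq. Qed.

Definition concat (p q : I -> X) : I -> X := fun t =>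
  if ival t <= 2^-1 then p (clamp (2 * ival t)) else q (clamp (2 * ival t - 1)).

Lemma concat_continuous (p q : I -> X) :
  continuous p -> continuous q -> p one = q zero -> continuous (concat p q).
Proof.
move=> cp cq pq; apply: continuous_paste.
- exact: ival_continuous.
- apply: continuous_path_comp cp; apply: continuous_clamp.
  under eq_fun do rewrite -[2 * _]addr0.
  by apply: continuous_affine; exact: ival_continuous.
- apply: continuous_path_comp cq; apply: continuous_clamp.
  by apply: continuous_affine; exact: ival_continuous.
- move=> t ->; have -> : 2 * 2^-1 = 1 :> R by rewrite divff ?pnatr_eq0.
  by rewrite subrr.
Qed.

Lemma concat0 (p q : I -> X) : concat p q zero = p zero.
Proof. by rewrite /concat ival0 invr_ge0 ler0n mulr0. Qed.

Lemma concat1 (p q : I -> X) : concat p q one = q one.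
Proof.
rewrite /concat ival1 ifN; last by rewrite -ltNge; lra.
by congr (q (clamp _)); lra.
Qed.

Lemma homotopic_sym (p q : I -> X) :
  homotopic_rel_ends p q -> homotopic_rel_ends q p.
Proof.
move=> hpq; have [p0 p1] := homotopic_ends hpq.
case: hpq => H [cH H0 H1 Hl Hr].
exists (fun ts => H (ts.1, clamp (1 - ival ts.2))).
have c01 : clamp (1 - 1) = zero :> I by rewrite subrr.
have c10 : clamp (1 - 0) = one :> I by rewrite subr0.
split => [|t|t|s|s] /=; rewrite ?ival0 ?ival1 ?c01 ?c10 ?Hl ?Hr //.
apply: continuous_path_comp cH; apply: continuous_pair.
  by move=> ts; exact: cvg_fst.
apply: continuous_clamp; under eq_fun do rewrite addrC -mulN1r.
by apply: continuous_affine; apply: continuous_ival => ts; exact: cvg_snd.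
Qed.

Lemma homotopic_trans (p q r : I -> X) :
  homotopic_rel_ends p q -> homotopic_rel_ends q r -> homotopic_rel_ends p r.
Proof.
move=> hpq hqr; have [pq0 pq1] := homotopic_ends hpq.
case: hpq => H [cH H0 H1 Hl Hr]; case: hqr => K [cK K0 K1 Kl Kr].
exists (fun ts => concat (fun s => H (ts.1, s)) (fun s => K (ts.1, s)) ts.2).
split => [|t|t|s|s] /=.
- apply: (@continuous_paste _ _ _ (fun ts : I * I => ival ts.2)).
  + by apply: continuous_ival => ts; exact: cvg_snd.
  + apply: continuous_path_comp cH; apply: continuous_pair.
      by move=> ts; exact: cvg_fst.
    apply: continuous_clamp; under eq_fun do rewrite -[2 * _]addr0.
    by apply: continuous_affine; apply: continuous_ival => ts; exact: cvg_snd.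
  + apply: continuous_path_comp cK; apply: continuous_pair.
      by move=> ts; exact: cvg_fst.
    apply: continuous_clamp.
    by apply: continuous_affine; apply: continuous_ival => ts; exact: cvg_snd.
  + move=> ts ->; have -> : 2 * 2^-1 = 1 :> R by rewrite divff ?pnatr_eq0.
    by rewrite subrr H1 K0.
- by rewrite concat0 H0.
- by rewrite concat1 K1.
- by rewrite /concat Hl Kl pq0 if_same.
- by rewrite /concat Hr Kr pq1 if_same.
Qed.

Lemma homotopic_concat (p p' q q' : I -> X) :
  p one = q zero -> homotopic_rel_ends p p' -> homotopic_rel_ends q q' ->
  homotopic_rel_ends (concat p q) (concat p' q').
Proof.
move=> pq [H [cH H0 H1 Hl Hr]] [K [cK K0 K1 Kl Kr]].
exists (fun ts => concat (fun t => H (t, ts.2)) (fun t => K (t, ts.2)) ts.1).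
split => [|t|t|s|s] /=.
- apply: (@continuous_paste _ _ _ (fun ts : I * I => ival ts.1)).
  + by apply: continuous_ival => ts; exact: cvg_fst.
  + apply: continuous_path_comp cH; apply: continuous_pair; last first.
      by move=> ts; exact: cvg_snd.
    apply: continuous_clamp; under eq_fun do rewrite -[2 * _]addr0.
    by apply: continuous_affine; apply: continuous_ival => ts; exact: cvg_fst.
  + apply: continuous_path_comp cK; apply: continuous_pair; last first.
      by move=> ts; exact: cvg_snd.
    apply: continuous_clamp.
    by apply: continuous_affine; apply: continuous_ival => ts; exact: cvg_fst.
  + move=> ts ->; have -> : 2 * 2^-1 = 1 :> R by rewrite divff ?pnatr_eq0.
    by rewrite subrr Hr Kl.
- by rewrite /concat H0 K0.
- by rewrite /concat H1 K1.
- by rewrite !concat0 Hl.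
- by rewrite !concat1 Kr.
Qed.

Lemma homotopic_reparam (p : I -> X) (phi psi : I -> I) :
  continuous p -> continuous phi -> continuous psi ->
  phi zero = psi zero -> phi one = psi one ->
  homotopic_rel_ends (p \o phi) (p \o psi).
Proof.
move=> cp cphi cpsi e0 e1.
exists (fun ts => p (clamp ((1 - ival ts.2) * ival (phi ts.1)
                            + ival ts.2 * ival (psi ts.1)))).
have cv (a b : R) : (1 - a) * b + a * b = b by ring.
split => [|t|t|s|s] /=.
- apply: continuous_path_comp cp; apply: continuous_clamp => ts.
  have c1 : {for ts, continuous (fun u : I * I => ival u.2)}.
    by apply: continuous_ival => u; exact: cvg_snd.
  have c2 : {for ts, continuous (fun u : I * I => ival (phi u.1))}.
    apply: continuous_ival; apply: continuous_path_comp cphi => u.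
    exact: cvg_fst.
  have c3 : {for ts, continuous (fun u : I * I => ival (psi u.1))}.
    apply: continuous_ival; apply: continuous_path_comp cpsi => u.
    exact: cvg_fst.
  apply: cvgD; apply: cvgM => //.
  by apply: cvgB => //; exact: cvg_cst.
- by rewrite ival0 subr0 mul1r mul0r addr0 ivalK.
- by rewrite ival1 subrr mul1r mul0r add0r ivalK.
- by rewrite e0 cv ivalK.
- by rewrite e1 cv ivalK.
Qed.

End Homotopy.

Lemma homotopic_comp (R : realType) (X Y : topologicalType) (f : X -> Y)
    (p q : unit_interval R -> X) :
  continuous f -> homotopic_rel_ends p q ->
  homotopic_rel_ends (f \o p) (f \o q).
Proof.
move=> cf [H [cH H0 H1 Hl Hr]]; exists (f \o H).
split => [|t|t|s|s] /=; rewrite ?H0 ?H1 ?Hl ?Hr //.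
exact: continuous_path_comp cH cf.
Qed.

Definition path_connected (R : realType) (X : topologicalType) : Prop :=
  forall x y : X, inhabited {path unit_interval R from x to y in X}.

Section LeftCosets.
Variables (G : groupType) (H : groupClosed G).

Definition left_coset_rel : rel G := fun x y => (x^-1 * y)%g \in H.

Lemma left_coset_rel_refl : reflexive left_coset_rel.
Proof. by move=> x; rewrite /left_coset_rel mulVg gpred1. Qed.

Lemma left_coset_rel_sym : symmetric left_coset_rel.
Proof.
by move=> x y; rewrite /left_coset_rel -(gpredV H (y^-1 * x)%g) invgM invgK.
Qed.

Lemma left_coset_rel_trans : transitive left_coset_rel.
Proof.
move=> y x z; rewrite /left_coset_rel => xy yz.
by have := gpredM _ _ xy yz; rewrite -mulgA mulVKg.
Qed.

Canonical left_coset_equiv := EquivRel left_coset_rel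
  left_coset_rel_refl left_coset_rel_sym left_coset_rel_trans.

Definition left_cosets : Type := {eq_quot left_coset_rel}.

HB.instance Definition _ := Choice.on left_cosets.

Definition left_coset (x : G) : left_cosets := \pi_({eq_quot left_coset_rel}) x.

Definition coset_repr (C : left_cosets) : G :=
  repr (C : {eq_quot left_coset_rel}).

Lemma coset_reprK (C : left_cosets) : left_coset (coset_repr C) = C.
Proof. exact: reprK. Qed.

Lemma left_coset_eq (x y : G) :
  left_coset x = left_coset y <-> (x^-1 * y)%g \in H.
Proof.
split=> [/eqP|xy]; first by rewrite /left_coset eqmodE.
by apply/eqP; rewrite /left_coset eqmodE.
Qed.

Definition normal_subgroup : Prop :=
  forall x y : G, y \in H -> (x^-1 * (y * x))%g \in H.

Definition quotient_group of normal_subgroup : Type := left_cosets.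

Section QuotientGroup.
Hypothesis nH : normal_subgroup.

HB.instance Definition _ := Choice.on (quotient_group nH).

Definition coset_mul (C D : quotient_group nH) : quotient_group nH :=
  left_coset (coset_repr C * coset_repr D)%g.

Definition coset_inv (C : quotient_group nH) : quotient_group nH :=
  left_coset (coset_repr C)^-1%g.

Lemma coset_mulE (x y : G) :
  coset_mul (left_coset x) (left_coset y) = left_coset (x * y)%g.
Proof.
apply/left_coset_eq.
have /left_coset_eq hx := coset_reprK (left_coset x).
have /left_coset_eq hy := coset_reprK (left_coset y).
set x' := coset_repr _ in hx *; set y' := coset_repr _ in hy *.
have -> : ((x' * y')^-1 * (x * y) =
           y'^-1 * ((x'^-1 * x) * y') * (y'^-1 * y))%g.
  by rewrite invgM !mulgA mulgK.
by apply: gpredM => //; exact: nH.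
Qed.

Lemma coset_invE (x : G) : coset_inv (left_coset x) = left_coset x^-1%g.
Proof.
apply/left_coset_eq; rewrite invgK.
have /left_coset_eq := esym (coset_reprK (left_coset x)).
set x' := coset_repr _ => /(nH x^-1%g).
by rewrite invgK mulgA mulVKg.
Qed.

Lemma coset_mulA : associative coset_mul.
Proof.
move=> C D E; rewrite -[C]coset_reprK -[D]coset_reprK -[E]coset_reprK.
by rewrite !coset_mulE mulgA.
Qed.

Lemma coset_mul1 : left_id (left_coset 1%g) coset_mul.
Proof. by move=> C; rewrite -[C]coset_reprK coset_mulE mul1g. Qed.

Lemma coset_mulr1 : right_id (left_coset 1%g) coset_mul.
Proof. by move=> C; rewrite -[C]coset_reprK coset_mulE mulg1. Qed.

Lemma coset_mulV : left_inverse (left_coset 1%g) coset_inv coset_mul.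
Proof.
by move=> C; rewrite -[C]coset_reprK coset_invE coset_mulE mulVg.
Qed.

Lemma coset_mulrV : right_inverse (left_coset 1%g) coset_inv coset_mul.
Proof.
by move=> C; rewrite -[C]coset_reprK coset_invE coset_mulE mulgV.
Qed.

HB.instance Definition _ := isGroup.Build (quotient_group nH)
  coset_mulA coset_mul1 coset_mulr1 coset_mulV coset_mulrV.

End QuotientGroup.
End LeftCosets.

Record homeo (X : topologicalType) : Type := Homeo {
  homeo_fun :> X -> X;
  homeo_inv : X -> X;
  homeo_funK : cancel homeo_fun homeo_inv;
  homeo_invK : cancel homeo_inv homeo_fun;
  homeo_continuous : continuous homeo_fun;
  homeo_inv_continuous : continuous homeo_inv }.

Section HomeoGroup.
Variable X : topologicalType.

Lemma homeo_eq (f g : homeo X) : f =1 g -> f = g.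
Proof.
move=> fg; have fgV : homeo_inv f =1 homeo_inv g.
  by move=> x; rewrite -[x in LHS](homeo_invK g) -fg homeo_funK.
case: f g fg fgV => f f' fK f'K cf cf' [g g' gK g'K cg cg'] /=.
move=> /funext fg /funext fg'.
subst; congr Homeo; exact: Prop_irrelevance.
Qed.

HB.instance Definition _ := gen_eqMixin (homeo X).
HB.instance Definition _ := gen_choiceMixin (homeo X).

Lemma id_homeo_continuous : continuous (@id X).
Proof. by move=> x; exact: cvg_id. Qed.

Definition homeo_id : homeo X := @Homeo X id id (fun=> erefl) (fun=> erefl)
  id_homeo_continuous id_homeo_continuous.

Definition homeo_comp (f g : homeo X) : homeo X :=
  Homeo (can_comp (homeo_funK f) (homeo_funK g))
    (can_comp (homeo_invK g) (homeo_invK f))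
    (continuous_path_comp (@homeo_continuous _ g) (@homeo_continuous _ f))
    (continuous_path_comp (@homeo_inv_continuous _ f)
      (@homeo_inv_continuous _ g)).

Definition homeo_sym (f : homeo X) : homeo X :=
  Homeo (homeo_invK f) (homeo_funK f)
    (@homeo_inv_continuous _ f) (@homeo_continuous _ f).

Lemma homeo_compA : associative homeo_comp.
Proof. by move=> f g h; apply: homeo_eq. Qed.

Lemma homeo_comp1 : left_id homeo_id homeo_comp.
Proof. by move=> f; apply: homeo_eq. Qed.

Lemma homeo_compr1 : right_id homeo_id homeo_comp.
Proof. by move=> f; apply: homeo_eq. Qed.

Lemma homeo_compV : left_inverse homeo_id homeo_sym homeo_comp.
Proof. by move=> f; apply: homeo_eq => x /=; rewrite homeo_funK. Qed.

Lemma homeo_comprV : right_inverse homeo_id homeo_sym homeo_comp.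
Proof. by move=> f; apply: homeo_eq => x /=; rewrite homeo_invK. Qed.

HB.instance Definition _ := isGroup.Build (homeo X)
  homeo_compA homeo_comp1 homeo_compr1 homeo_compV homeo_comprV.

Lemma homeo_mulE (f g : homeo X) (x : X) : (f * g)%g x = f (g x).
Proof. by []. Qed.

Definition homeo_orbit (x0 : X) : set X := [set g x0 | g in [set: homeo X]].

Lemma orbit_refl (x0 : X) : homeo_orbit x0 x0.
Proof. by exists 1%g. Qed.

Lemma orbit_act (x0 x : X) (g : homeo X) :
  homeo_orbit x0 x -> homeo_orbit x0 (g x).
Proof. by move=> [h _ <-]; exists (g * h)%g. Qed.

Definition isotropy (x0 : X) : {pred homeo X} :=
  [pred g : homeo X | `[< g x0 = x0 >]].

Lemma isotropyP (x0 : X) (g : homeo X) : g \in isotropy x0 <-> g x0 = x0.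
Proof. by rewrite inE /=; split=> [/asboolP|gx] //; apply/asboolP. Qed.

Lemma isotropy_mul_closed (x0 : X) : mulg_closed (isotropy x0).
Proof.
move=> f g /isotropyP fx /isotropyP gx; apply/isotropyP.
by rewrite homeo_mulE gx.
Qed.

Lemma isotropy1 (x0 : X) : 1%g \in isotropy x0.
Proof. exact/isotropyP. Qed.

Lemma isotropy_inv_closed (x0 : X) : invg_closed (isotropy x0).
Proof.
move=> f /isotropyP fx; apply/isotropyP; rewrite -[x0 in LHS]fx.
exact: homeo_funK.
Qed.

HB.instance Definition _ (x0 : X) :=
  isMulClosed.Build (homeo X) (isotropy x0) (@isotropy_mul_closed x0).
HB.instance Definition _ (x0 : X) :=
  isMul1Closed.Build (homeo X) (isotropy x0) (@isotropy1 x0).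
HB.instance Definition _ (x0 : X) :=
  isInvClosed.Build (homeo X) (isotropy x0) (@isotropy_inv_closed x0).

End HomeoGroup.

(* A choice, for each point [x] of the orbit of [x0], of a homeomorphism
   carrying [x0] to [x], that is, of a representative of the coset attached to
   [x]; the values outside of the orbit are irrelevant. *)
Record orbit_reps (X : topologicalType) (x0 : X) : Type := OrbitReps {
  orbit_rep :> X -> homeo X;
  orbit_repE : forall x, homeo_orbit x0 x -> orbit_rep x x0 = x }.

Section FundamentalGroup.
Variables (R : realType) (X : topologicalType) (x0 : X).
Local Notation I := (unit_interval R).
Local Notation loop := {path I from x0 to x0 in X}.

Definition loop_rel : rel loop := fun p q => `[< homotopic_rel_ends p q >].

Lemma loop_rel_refl : reflexive loop_rel.
Proof. by move=> p; apply/asboolP/homotopic_refl; exact: cts_fun. Qed.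

Lemma loop_rel_sym : symmetric loop_rel.
Proof.
by move=> p q; apply/asboolP/asboolP => /homotopic_sym.
Qed.

Lemma loop_rel_trans : transitive loop_rel.
Proof.
move=> q p r /asboolP pq /asboolP qr; apply/asboolP.
exact: homotopic_trans pq qr.
Qed.

Canonical loop_equiv :=
  EquivRel loop_rel loop_rel_refl loop_rel_sym loop_rel_trans.

Definition pi1 : Type := {eq_quot loop_rel}.

HB.instance Definition _ := Choice.on pi1.

Definition loop_class (p : loop) : pi1 := \pi_({eq_quot loop_rel}) p.

Definition loop_repr (c : pi1) : loop := repr (c : {eq_quot loop_rel}).

Lemma loop_reprK (c : pi1) : loop_class (loop_repr c) = c.
Proof. exact: reprK. Qed.

Lemma loop_class_eq (p q : loop) :
  loop_class p = loop_class q <-> homotopic_rel_ends p q.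
Proof.
split=> [/eqP|pq]; first by rewrite /loop_class eqmodE => /asboolP.
by apply/eqP; rewrite /loop_class eqmodE; apply/asboolP.
Qed.

Lemma loop_reprP (p : loop) : homotopic_rel_ends (loop_repr (loop_class p)) p.
Proof. exact/loop_class_eq/loop_reprK. Qed.

Section LoopOperations.
Variables p q : loop.

Lemma loop_concat_continuous : continuous (concat p q).
Proof.
by apply: concat_continuous; [exact: cts_fun..|rewrite path_one path_zero].
Qed.

Lemma loop_concat0 : concat p q zero = x0.
Proof. by rewrite concat0 path_zero. Qed.

Lemma loop_concat1 : concat p q one = x0.
Proof. by rewrite concat1 path_one. Qed.

Definition loop_concat : loop :=
  mk_path loop_concat_continuous loop_concat0 loop_concat1.

Definition reverse : I -> X := fun t => p (clamp (1 - ival t)).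

Lemma reverse_clamp_continuous :
  continuous (fun t : I => clamp (1 - ival t)).
Proof.
apply: continuous_clamp; under eq_fun do rewrite addrC -mulN1r.
by apply: continuous_affine; exact: ival_continuous.
Qed.

Lemma reverse_continuous : continuous reverse.
Proof.
by apply: continuous_path_comp reverse_clamp_continuous _; exact: cts_fun.
Qed.

Lemma reverse0 : reverse zero = x0.
Proof. by rewrite /reverse ival0 subr0 -[clamp 1]/one path_one. Qed.

Lemma reverse1 : reverse one = x0.
Proof. by rewrite /reverse ival1 subrr -[clamp 0]/zero path_zero. Qed.

Definition loop_reverse : loop := mk_path reverse_continuous reverse0 reverse1.

End LoopOperations.

Definition loop_cst : loop := cst x0.

Definition pi1_mul (c d : pi1) : pi1 :=
  loop_class (loop_concat (loop_repr c) (loop_repr d)).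
Definition pi1_one : pi1 := loop_class loop_cst.
Definition pi1_inv (c : pi1) : pi1 := loop_class (loop_reverse (loop_repr c)).

Lemma pi1_mulE (p q : loop) :
  pi1_mul (loop_class p) (loop_class q) = loop_class (loop_concat p q).
Proof.
apply/loop_class_eq; apply: homotopic_concat; try exact: loop_reprP.
by rewrite path_one path_zero.
Qed.

Lemma loop_reparam (r p q : loop) (phi psi : I -> I) :
  continuous phi -> continuous psi -> phi zero = psi zero ->
  phi one = psi one -> p =1 r \o phi -> q =1 r \o psi ->
  loop_class p = loop_class q.
Proof.
move=> cphi cpsi e0 e1 /funext pE /funext qE; apply/loop_class_eq.
rewrite pE qE; apply: homotopic_reparam => //; exact: cts_fun.
Qed.

Lemma affine_continuous (a b : R) : continuous (fun t : I => a * ival t + b).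
Proof. by apply: continuous_affine; exact: ival_continuous. Qed.

Lemma id_interval_continuous : continuous (fun t : I => t).
Proof. by move=> t; exact: cvg_id. Qed.

Lemma pi1_mulA : associative pi1_mul.
Proof.
move=> c d e; rewrite -[c]loop_reprK -[d]loop_reprK -[e]loop_reprK !pi1_mulE.
move: (loop_repr c) (loop_repr d) (loop_repr e) => p q r.
pose f (t : I) : R :=
  Num.min (2 * ival t + 0) (Num.min (1 * ival t + 4^-1) (2^-1 * ival t + 2^-1)).
apply: (@loop_reparam (loop_concat p (loop_concat q r)) _ _ id
  (fun t => clamp (f t))) => //.
- exact: id_interval_continuous.
- apply: continuous_clamp; apply: continuous_minr.
    exact: affine_continuous.
  by apply: continuous_minr; exact: affine_continuous.
- apply: ival_inj; rewrite clampE /f ival0.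
    by rewrite min_l ?le_min; lra.
  by rewrite min_l ?le_min; lra.
- apply: ival_inj; rewrite clampE /f ival1.
    by rewrite [Num.min (1 * 1 + _) _]min_r ?min_r; lra.
  by rewrite [Num.min (1 * 1 + _) _]min_r ?min_r; lra.
move=> t /=; rewrite /loop_concat /mk_path /=.
have t0 := ival_ge0 t; have t1 := ival_le1 t.
have [h2|h2] := leP (ival t) 2^-1; last first.
  have fE : f t = 2^-1 * ival t + 2^-1 by rewrite /f !min_r //; lra.
  rewrite {1}/concat ifN -?ltNge // {1}/concat fE clampE; last by lra.
  rewrite ifN -?ltNge; last by lra.
  rewrite {1}/concat clampE; last by lra.
  rewrite ifN -?ltNge; last by lra.
  by congr (r (clamp _)); lra.
have [h4|h4] := leP (ival t) 4^-1.
  have fE : f t = 2 * ival t + 0.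
    by rewrite /f min_l // le_min; apply/andP; split; lra.
  rewrite {1}/concat h2 {1}/concat clampE; last by lra.
  rewrite ifT; last by lra.
  rewrite /concat fE clampE; last by lra.
  rewrite ifT; last by lra.
  by congr (p (clamp _)); lra.
have fE : f t = 1 * ival t + 4^-1.
  rewrite /f [Num.min (1 * _ + _) _]min_l; last by lra.
  by rewrite min_r //; lra.
rewrite {1}/concat h2 {1}/concat clampE; last by lra.
rewrite ifN -?ltNge; last by lra.
rewrite {1}/concat fE clampE; last by lra.
rewrite ifN -?ltNge; last by lra.
rewrite /concat clampE; last by lra.
rewrite ifT; last by lra.
by congr (q (clamp _)); lra.
Qed.

Lemma pi1_mul1 : left_id pi1_one pi1_mul.
Proof.
move=> c; rewrite -[c]loop_reprK /pi1_one pi1_mulE.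
move: (loop_repr c) => p.
apply: (@loop_reparam p _ _ (fun t => clamp (2 * ival t + -1)) id) => //.
- by apply: continuous_clamp; exact: affine_continuous.
- exact: id_interval_continuous.
- by rewrite ival0 clamp_le0 //; lra.
- by rewrite ival1 clamp_ge1 //; lra.
move=> t /=; rewrite /loop_concat /mk_path /concat /=; case: ifPn => // h.
rewrite [clamp (_ + -1)]clamp_le0; last by lra.
by rewrite -[clamp 0]/(zero : I) path_zero.
Qed.

Lemma pi1_mulr1 : right_id pi1_one pi1_mul.
Proof.
move=> c; rewrite -[c]loop_reprK /pi1_one pi1_mulE.
move: (loop_repr c) => p.
apply: (@loop_reparam p _ _ (fun t => clamp (2 * ival t + 0)) id) => //.
- by apply: continuous_clamp; exact: affine_continuous.
- exact: id_interval_continuous.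
- by rewrite ival0 clamp_le0 //; lra.
- by rewrite ival1 clamp_ge1 //; lra.
move=> t /=; rewrite /loop_concat /mk_path /concat /=; case: ifPn => [|h].
  by rewrite addr0.
move: h; rewrite -ltNge => h; rewrite [clamp (_ + 0)]clamp_ge1; last by lra.
by rewrite -[clamp 1]/(one : I) path_one.
Qed.

Lemma loop_concat_reverse (p : loop) :
  loop_class (loop_concat p (loop_reverse p)) = pi1_one.
Proof.
apply: (@loop_reparam p _ _
  (fun t => clamp (Num.min (2 * ival t + 0) (- 2 * ival t + 2)))
  (fun=> zero)) => //.
- by apply: continuous_clamp; apply: continuous_minr; exact: affine_continuous.
- exact: cst_continuous.
- by rewrite ival0 clamp_le0 // ge_min; apply/orP; left; lra.
- by rewrite ival1 clamp_le0 // ge_min; apply/orP; right; lra.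
- move=> t /=; rewrite /loop_concat /loop_reverse /mk_path /concat /reverse /=.
  have t0 := ival_ge0 t; have t1 := ival_le1 t.
  case: ifPn => h; first by rewrite min_l ?addr0 //; lra.
  move: h; rewrite -ltNge => h.
  rewrite clampE; last by lra.
  by rewrite min_r; [congr (p (clamp _))|]; lra.
- by move=> t /=; rewrite path_zero.
Qed.

Lemma loop_reverseK (p : loop) : loop_reverse (loop_reverse p) = p.
Proof.
apply/path_eqP => t; change (p (clamp (1 - ival (clamp (1 - ival t)))) = p t).
have t0 := ival_ge0 t; have t1 := ival_le1 t.
rewrite clampE; last by lra.
by rewrite opprB addrC subrK ivalK.
Qed.

Lemma pi1_inv_class (c : pi1) :
  pi1_inv c = loop_class (loop_reverse (loop_repr c)).
Proof. by []. Qed.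

Lemma pi1_mulV : left_inverse pi1_one pi1_inv pi1_mul.
Proof.
move=> c; rewrite pi1_inv_class -{2}[c]loop_reprK pi1_mulE.
by rewrite -[X in loop_concat _ X]loop_reverseK loop_concat_reverse.
Qed.

Lemma pi1_mulrV : right_inverse pi1_one pi1_inv pi1_mul.
Proof.
by move=> c; rewrite -{1}[c]loop_reprK pi1_mulE loop_concat_reverse.
Qed.

HB.instance Definition _ := isGroup.Build pi1
  pi1_mulA pi1_mul1 pi1_mulr1 pi1_mulV pi1_mulrV.

End FundamentalGroup.

Section ExtendedPaths.
Variables (R : realType) (X : topologicalType) (x0 : X).
Local Notation I := (unit_interval R).

Record orbit_path : Type := OrbitPath {
  orbit_path_end : X;
  orbit_path_endP : homeo_orbit x0 orbit_path_end;
  orbit_path_path :> {path I from x0 to orbit_path_end in X} }.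

HB.instance Definition _ := gen_eqMixin orbit_path.
HB.instance Definition _ := gen_choiceMixin orbit_path.

Definition orbit_path_rel : rel orbit_path :=
  fun a b => `[< homotopic_rel_ends a b >].

Lemma orbit_path_rel_refl : reflexive orbit_path_rel.
Proof. by move=> p; apply/asboolP/homotopic_refl; exact: cts_fun. Qed.

Lemma orbit_path_rel_sym : symmetric orbit_path_rel.
Proof. by move=> p q; apply/asboolP/asboolP => /homotopic_sym. Qed.

Lemma orbit_path_rel_trans : transitive orbit_path_rel.
Proof.
move=> q p r /asboolP pq /asboolP qr; apply/asboolP.
exact: homotopic_trans pq qr.
Qed.

Canonical orbit_path_equiv := EquivRel orbit_path_rel
  orbit_path_rel_refl orbit_path_rel_sym orbit_path_rel_trans.

(* The carrier does not depend on the chosen representatives, only the product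
   below does; the phantom parameter keeps track of them. *)
Definition ext_pi1 of orbit_reps x0 : Type := {eq_quot orbit_path_rel}.

Section ExtOperation.
Variable g : orbit_reps x0.

HB.instance Definition _ := Choice.on (ext_pi1 g).

Definition ext_class (a : orbit_path) : ext_pi1 g :=
  \pi_({eq_quot orbit_path_rel}) a.

Definition ext_repr (c : ext_pi1 g) : orbit_path :=
  repr (c : {eq_quot orbit_path_rel}).

Lemma ext_reprK (c : ext_pi1 g) : ext_class (ext_repr c) = c.
Proof. exact: reprK. Qed.

Lemma ext_class_eq (a b : orbit_path) :
  ext_class a = ext_class b <-> homotopic_rel_ends a b.
Proof.
split=> [/eqP|ab]; first by rewrite /ext_class eqmodE => /asboolP.
by apply/eqP; rewrite /ext_class eqmodE; apply/asboolP.
Qed.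

Lemma ext_reprP (a : orbit_path) :
  homotopic_rel_ends (ext_repr (ext_class a)) a.
Proof. exact/ext_class_eq/ext_reprK. Qed.

Lemma orbit_path_end_eq (a b : orbit_path) :
  homotopic_rel_ends a b -> orbit_path_end a = orbit_path_end b.
Proof. by move=> /homotopic_ends[_]; rewrite !path_one. Qed.

Section ExtConcat.
Variables a b : orbit_path.
Local Notation ga := (g (orbit_path_end a)).

Lemma ext_concat_match : a one = (ga \o b) zero.
Proof.
by rewrite /= path_one path_zero orbit_repE //; exact: orbit_path_endP.
Qed.

Lemma ext_concat_continuous : continuous (concat a (ga \o b)).
Proof.
apply: concat_continuous ext_concat_match; first exact: cts_fun.
by apply: continuous_path_comp; [exact: cts_fun|exact: homeo_continuous].
Qed.

Lemma ext_concat0 : concat a (ga \o b) zero = x0.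
Proof. by rewrite concat0 path_zero. Qed.

Lemma ext_concat1 : concat a (ga \o b) one = ga (orbit_path_end b).
Proof. by rewrite concat1 /= path_one. Qed.

Definition ext_concat : orbit_path :=
  OrbitPath (orbit_act ga (orbit_path_endP b))
    (mk_path ext_concat_continuous ext_concat0 ext_concat1).

End ExtConcat.

Definition ext_mul (c d : ext_pi1 g) : ext_pi1 g :=
  ext_class (ext_concat (ext_repr c) (ext_repr d)).

(* Only a magma structure is declared: for arbitrary representatives the product
   may fail to be a group law.  For instance, let [x0] be the wedge point of a
   figure eight, fixed by every homeomorphism, and let [g x0] swap the two
   circles: the class of the constant loop is then a right identity but not a
   left one. *)
HB.instance Definition _ := hasMul.Build (ext_pi1 g) ext_mul.

Lemma ext_mulE (a b : orbit_path) :
  (ext_class a * ext_class b)%g = ext_class (ext_concat a b).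
Proof.
apply/ext_class_eq; apply: homotopic_concat.
- exact: ext_concat_match.
- exact: ext_reprP.
- rewrite (orbit_path_end_eq (ext_reprP a)).
  by apply: homotopic_comp (ext_reprP b); exact: homeo_continuous.
Qed.

Definition ext_incl (c : pi1 R x0) : ext_pi1 g :=
  ext_class (OrbitPath (orbit_refl x0) (loop_repr c)).

Lemma ext_inclE (p : {path I from x0 to x0 in X}) :
  ext_incl (loop_class p) = ext_class (OrbitPath (orbit_refl x0) p).
Proof. by apply/ext_class_eq; exact: loop_reprP. Qed.

Definition Delta (c : ext_pi1 g) : left_cosets (isotropy x0) :=
  left_coset (isotropy x0) (g (orbit_path_end (ext_repr c))).

Lemma DeltaE (a : orbit_path) :
  Delta (ext_class a) = left_coset (isotropy x0) (g (orbit_path_end a)).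
Proof. by rewrite /Delta (orbit_path_end_eq (ext_reprP a)). Qed.

End ExtOperation.
End ExtendedPaths.

Definition is_group (M : magmaType) : Prop :=
  (forall x y z : M, (x * (y * z) = x * y * z)%g) /\
  exists e : M,
    (forall x : M, (e * x = x)%g /\ (x * e = x)%g) /\
    (forall x : M, exists y : M, (y * x = e)%g /\ (x * y = e)%g).

(* Exactness of [1 -> A -> B -> C -> 1] for a pointed set [C] with base point
   [c]. *)
Definition short_exact_maps (A B C : Type) (c : C) (i : A -> B) (p : B -> C)
    : Prop :=
  [/\ injective i, range i = p @^-1` [set c] & range p = [set: C]].

Definition short_exact_groups (A : groupType) (B : magmaType) (C : groupType)
    (i : A -> B) (p : B -> C) : Prop :=
  [/\ is_group B, {morph i : x y / (x * y)%g}, {morph p : x y / (x * y)%g} &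
      short_exact_maps 1%g i p].

(* Main.v *)
(* Two homeomorphisms carrying x0 to the same point lie in the same left coset
   of the isotropy group; this computes Delta, gives its multiplicativity and
   its kernel, and path-connectedness gives its surjectivity.  The inclusion of
   pi_1 is multiplicative only if g_{x0} q is homotopic to q for loops q at x0.
   This is where the group axioms enter: the constant class is always a right
   identity, hence it is the two-sided identity e of the extended group, and
   e [q] = [q] reads [g_{x0} q] = [q]. *)
Require Import Defs.
From HB Require Import structures.
From mathcomp Require Import all_boot all_order all_algebra.
From mathcomp Require Import all_classical all_reals topology normedtype.
From mathcomp Require Import continuous_path.
From mathcomp Require Import lra.

Set Implicit Arguments.
Unset Strict Implicit.
Unset Printing Implicit Defensive.

Import Order.TTheory GRing.Theory Num.Theory.

Local Open Scope classical_set_scope.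
Local Open Scope ring_scope.

Section ConstantPaths.
Variables (R : realType) (X : topologicalType).
Local Notation I := (unit_interval R).

Lemma clamp_affine_continuous (a b : R) :
  continuous (fun t : I => clamp (a * ival t + b)).
Proof.
by apply: continuous_clamp; apply: continuous_affine; exact: ival_continuous.
Qed.

(** The concatenation is [p] reparametrised by [t -> min(2t, 1)], with [clamp] doing the truncation;
    a straight-line homotopy in the interval joins this map to the identity. *)
Lemma concat_cstr (p : I -> X) :
  continuous p -> homotopic_rel_ends (concat p (cst (p one))) p.
Proof.
move=> cp.
have -> : concat p (cst (p one)) = p \o (fun t => clamp (2 * ival t + 0)).
  apply/funext => t; rewrite /concat /=; case: ifPn => [|h].
    by rewrite addr0.
  move: h; rewrite -ltNge => h.
  by rewrite [clamp (_ + 0)]clamp_ge1 //; lra.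
rewrite -[X in homotopic_rel_ends _ X]/(p \o id).
apply: homotopic_reparam => //.
- exact: clamp_affine_continuous.
- by move=> t; exact: cvg_id.
- by rewrite ival0 clamp_le0 //; lra.
- by rewrite ival1 clamp_ge1 //; lra.
Qed.

Lemma concat_cstl (p : I -> X) :
  continuous p -> homotopic_rel_ends (concat (cst (p zero)) p) p.
Proof.
move=> cp.
(* The parameter is [max(2t - 1, 0)]: it waits at 0 during the first half. *)
have -> : concat (cst (p zero)) p = p \o (fun t => clamp (2 * ival t + -1)).
  apply/funext => t; rewrite /concat /=; case: ifPn => [h|//].
  by rewrite [clamp (_ + -1)]clamp_le0 //; lra.
rewrite -[X in homotopic_rel_ends _ X]/(p \o id).
apply: homotopic_reparam => //.
- exact: clamp_affine_continuous.
- by move=> t; exact: cvg_id.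
- by rewrite ival0 clamp_le0 //; lra.
- by rewrite ival1 clamp_ge1 //; lra.
Qed.

End ConstantPaths.

Section ExtendedSequence.
Variables (R : realType) (X : topologicalType) (x0 : X) (g : orbit_reps x0).
Local Notation I := (unit_interval R).
Local Notation incl := (@ext_incl R X x0 g).
Local Notation Delta := (@Delta R X x0 g).

(** Orbit-stabiliser: this turns every equation between cosets below into one between points of the
    orbit. *)
Lemma left_coset_isotropy_eq (h k : homeo X) :
  left_coset (isotropy x0) h = left_coset (isotropy x0) k <-> h x0 = k x0.
Proof.
split=> [/left_coset_eq/isotropyP|hk].
  by rewrite homeo_mulE => /(congr1 h); rewrite [LHS]homeo_invK => ->.
by apply/left_coset_eq/isotropyP; rewrite homeo_mulE -hk; exact: homeo_funK.
Qed.

(** The chosen representatives drop out, since [g x] carries [x0] to [x]: [Delta] only records the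
    endpoint. *)
Lemma Delta_class_eq (a : orbit_path R x0) (h : homeo X) :
  Delta (ext_class g a) = left_coset (isotropy x0) h <->
  orbit_path_end a = h x0.
Proof.
rewrite DeltaE left_coset_isotropy_eq orbit_repE //; exact: orbit_path_endP.
Qed.

Lemma ext_incl_inj : injective incl.
Proof.
move=> c d; rewrite -[c]loop_reprK -[d]loop_reprK !ext_inclE.
by move=> /ext_class_eq cd; apply/loop_class_eq.
Qed.

Lemma range_ext_incl :
  range incl = Delta @^-1` [set left_coset (isotropy x0) 1%g].
Proof.
apply/seteqP; split=> [_ [c _ <-]|c] /=; first exact/Delta_class_eq.
rewrite -[c]ext_reprK; case: (ext_repr c) => e eP p /Delta_class_eq /= ex0.
(* The identity homeomorphism is evaluated by conversion, so that [subst] can retype [p] as a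
   loop. *)
have {}ex0 : e = x0 by exact: ex0.
subst e; exists (loop_class p) => //.
by rewrite ext_inclE; apply/ext_class_eq/homotopic_refl; exact: cts_fun.
Qed.

Lemma range_Delta : path_connected R X -> range Delta = setT.
Proof.
move=> pcX; apply/seteqP; split=> // C _.
rewrite -[C]coset_reprK; set h := coset_repr C.
have [p] := pcX x0 (h x0).
have hP : homeo_orbit x0 (h x0) by exists h.
by exists (ext_class g (OrbitPath hP p)) => //; exact/Delta_class_eq.
Qed.

(** The representative at the endpoint of [a] moves the constant loop at [x0] to the constant path
    at that endpoint. *)
Lemma ext_mul_cst (c : ext_pi1 R g) :
  (c * incl (loop_class (@loop_cst R X x0)))%g = c.
Proof.
rewrite -[c]ext_reprK ext_inclE ext_mulE; apply/ext_class_eq.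
move: (ext_repr c) => a.
have -> : (ext_concat g a (OrbitPath (orbit_refl x0) (@loop_cst R X x0))
    : I -> X) = concat a (cst (a one)).
  rewrite [LHS]/(concat _ _); congr concat; apply/funext => t.
  rewrite /= path_one orbit_repE //; exact: orbit_path_endP.
by apply: concat_cstr; exact: cts_fun.
Qed.

Lemma ext_cst_mul (c : ext_pi1 R g) :
  is_group (ext_pi1 R g) -> (incl (loop_class (@loop_cst R X x0)) * c)%g = c.
Proof.
move=> [_ [e [e1 _]]].
(* The product of [e] with the constant class equals both [e] and the constant class. *)
by have := ext_mul_cst e; rewrite (e1 _).1 => ->; rewrite (e1 c).1.
Qed.

Lemma orbit_rep_loop_homotopic (q : {path I from x0 to x0 in X}) :
  is_group (ext_pi1 R g) -> homotopic_rel_ends (g x0 \o q) q.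
Proof.
move=> gE.
have := ext_cst_mul (ext_class g (OrbitPath (orbit_refl x0) q)) gE.
rewrite ext_inclE ext_mulE => /ext_class_eq; apply: homotopic_trans.
apply: homotopic_sym.
(* The moved loop still starts at [x0], so the constant factor in the product is the one that
   [concat_cstl] absorbs. *)
have gx0 : (g x0 \o q) zero = x0.
  by rewrite /= path_zero orbit_repE //; exact: orbit_refl.
have /= := @concat_cstl R X (g x0 \o q).
rewrite -[g x0 (q zero)]/((g x0 \o q) zero) gx0.
by apply; apply: continuous_path_comp; [exact: cts_fun|exact: homeo_continuous].
Qed.

(** The two products differ only in their second factor, [q] against [g x0 \o q]. *)
Lemma ext_inclM :
  is_group (ext_pi1 R g) -> {morph incl : x y / (x * y)%g}.
Proof.
move=> gE c d; rewrite -[c]loop_reprK -[d]loop_reprK.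
rewrite [(loop_class _ * _)%g]pi1_mulE !ext_inclE ext_mulE.
apply/ext_class_eq; apply: homotopic_concat.
- by rewrite path_one path_zero.
- by apply: homotopic_refl; exact: cts_fun.
- by apply: homotopic_sym; exact: orbit_rep_loop_homotopic.
Qed.

Lemma DeltaM (nS : normal_subgroup (isotropy x0)) :
  {morph (Delta : _ -> quotient_group nS) : x y / (x * y)%g}.
Proof.
move=> c d; rewrite -[c]ext_reprK -[d]ext_reprK ext_mulE.
rewrite !DeltaE [RHS](coset_mulE nS).
(* Evaluated at [x0], both sides give the endpoint of the product path. *)
apply/left_coset_isotropy_eq.
rewrite homeo_mulE (@orbit_repE _ _ g (orbit_path_end (ext_repr d))); last first.
  exact: orbit_path_endP.
by rewrite orbit_repE //; apply: orbit_act; exact: orbit_path_endP.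
Qed.

End ExtendedSequence.

Theorem theorem4p1 (R : realType) (X : topologicalType) (x0 : X)
    (X_path_connected : path_connected R X) (g : orbit_reps x0) :
  short_exact_maps (left_coset (isotropy x0) 1%g)
    (@ext_incl R X x0 g) (@Delta R X x0 g) /\
  (is_group (ext_pi1 R g) ->
   forall nS : normal_subgroup (isotropy x0),
     @short_exact_groups (pi1 R x0) (ext_pi1 R g) (quotient_group nS)
       (@ext_incl R X x0 g) (@Delta R X x0 g)).
Proof.
have exact_maps : short_exact_maps (left_coset (isotropy x0) 1%g)
    (@ext_incl R X x0 g) (@Delta R X x0 g).
  split; [exact: ext_incl_inj|exact: range_ext_incl|exact: range_Delta].
split=> // gE nS; split => //; [exact: ext_inclM|exact: DeltaM].
Qed.
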